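(* Let $X$ be a Banach space with no nontrivial cotype. Then $D(X)\le 4^+$.
   Context: A Banach space $X$ has no nontrivial cotype if it does not have (Rademacher) cotype $q$ for any $q<\infty$. A metric space is locally finite if each ball of finite radius in it has finite cardinality. For $1\le C<\infty$, a map $f:(A,d_A)\to(Y,d_Y)$ between metric spaces is a $C$-bilipschitz embedding if there exists $r>0$ such that $r\,d_A(u,v)\le d_Y(f(u),f(v))\le rC\,d_A(u,v)$ for all $u,v\in A$. A bilipschitz embedding is a map that is $C$-bilipschitz for some such $C$. The distortion of $f$ is the smallest $C$ for which such an $r$ exists. For a Banach space $X$ and a real number $\alpha\ge 1$: (1) $D(X)\le\alpha$ means that, for every $C\in[1,\infty)$ and every locally finite metric space $A$ all of whose finite subsets admit bilipschitz embeddings into $X$ with distortions $\le C$, the space $A$ itself admits a bilipschitz embedding into $X$ with distortion $\le\alpha\cdot C$. (2) $D(X)=\alpha^+$ means that $D(X)\le\alpha+\varepsilon$ holds for every $\varepsilon>0$, while $D(X)\le\alpha$ does not hold. (3) $D(X)\le\alpha^+$ means that $D(X)=\alpha^+$ or $D(X)\le\alpha$ (equivalently, $D(X)\le\alpha+\varepsilon$ for every $\varepsilon>0$). *)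

(* Defs.v *)
From HB Require Import structures.
From mathcomp Require Import all_boot all_order all_algebra.
From mathcomp Require Import all_classical all_reals all_analysis.
Import Order.TTheory GRing.Theory Num.Theory.
Import numFieldNormedType.Exports.

Set Implicit Arguments.
Unset Strict Implicit.
Unset Printing Implicit Defensive.

Local Open Scope classical_set_scope.
Local Open Scope ring_scope.

(* E `|sum_i e_i x_i|^q over independent uniform signs e_i = (-1)^(s i) *)
Definition rademacher_moment (R : realType) (X : normedModType R) (q : R)
    (n : nat) (x : 'I_n -> X) : R :=
  (2 ^+ n)^-1 *
  \sum_(s : {ffun 'I_n -> bool}) `|\sum_(i < n) (-1) ^+ s i *: x i| `^ q.

(* By Kahane's inequality, replacing the q-th moment by any other finite
   moment only changes the constant C. *)
Definition rademacher_cotype (R : realType) (X : normedModType R) (q : R) :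
    Prop :=
  2 <= q /\
  exists2 C : R, 0 < C &
    forall (n : nat) (x : 'I_n -> X),
      (\sum_(i < n) `|x i| `^ q) `^ q^-1 <=
      C * (rademacher_moment q x) `^ q^-1.

Definition no_nontrivial_cotype (R : realType) (X : normedModType R) : Prop :=
  forall q : R, ~ rademacher_cotype X q.

Definition locally_finite (R : realType) (A : metricType R) : Prop :=
  forall (a : A) (r : R), finite_set (ball a r).

(* A map defined on a subset B of A is represented by a total function on A
   of which only the values on B matter. *)
Definition C_bilipschitz (R : realType) (A : metricType R)
    (X : normedModType R) (B : set A) (C : R) (f : A -> X) : Prop :=
  1 <= C /\
  exists2 r : R, 0 < r &
    forall u v, B u -> B v ->
      r * mdist u v <= `|f u - f v| /\ `|f u - f v| <= r * C * mdist u v.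

Definition bilipschitz (R : realType) (A : metricType R)
    (X : normedModType R) (B : set A) (f : A -> X) : Prop :=
  exists C : R, C_bilipschitz B C f.

(* For a bilipschitz f this infimum is a minimum; for other f it is the junk
   value inf set0. *)
Definition distortion (R : realType) (A : metricType R)
    (X : normedModType R) (B : set A) (f : A -> X) : R :=
  inf [set C : R | C_bilipschitz B C f].

Definition embeds_with_distortion_le (R : realType) (A : metricType R)
    (X : normedModType R) (B : set A) (C : R) : Prop :=
  exists2 f : A -> X, bilipschitz B f & distortion B f <= C.

(* D(X) is not introduced as a number: D_le X alpha, D_eq_plus X alpha and
   D_le_plus X alpha stand for the assertions D(X) <= alpha, D(X) = alpha^+ and
   D(X) <= alpha^+. *)
Definition D_le (R : realType) (X : normedModType R) (alpha : R) : Prop :=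
  forall C : R, 1 <= C ->
  forall A : metricType R, locally_finite A ->
    (forall B : set A, finite_set B -> embeds_with_distortion_le X B C) ->
    embeds_with_distortion_le X [set: A] (alpha * C).

Definition D_eq_plus (R : realType) (X : normedModType R) (alpha : R) : Prop :=
  (forall eps : R, 0 < eps -> D_le X (alpha + eps)) /\ ~ D_le X alpha.

Definition D_le_plus (R : realType) (X : normedModType R) (alpha : R) : Prop :=
  D_eq_plus X alpha \/ D_le X alpha.

(* Main.v *)
(* If X does not contain K-isomorphic copies of all l_infty^n (K > 1), then for
   some n the q-th Rademacher moment of any n vectors is, for q large, at least
   (2 / (2n - 1)) times the sum of the q-th powers of their norms, and an
   induction that splits a family into n blocks of equal weight turns this gain
   over 1 / n into a cotype. So X contains l_infty^n's, even ones on which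
   finitely many given norming functionals vanish. Frechet embeddings psi_k of
   the balls of a growing sequence into such copies, each copy annihilated by
   the functionals norming the differences of psi_(k-1), are glued by
   interpolating linearly between psi_k(x) and psi_(k+1)(x) along a slowly
   varying function of |x| = d(o, x). Up to a small error, f(x) - f(y) is then
   (1 - t) u + t v with |u|, |v| about d(x, y) and |s u + v| >= |s u| for all s,
   whence |f(x) - f(y)| >= d(x, y) / 3: the distortion is close to 3, thus
   at most 4. *)

Require Import Defs.
From mathcomp Require Import all_boot all_order all_algebra.
From mathcomp Require Import all_classical all_reals all_analysis.
From mathcomp Require Import ring lra.
Import Order.TTheory GRing.Theory Num.Theory.
Import numFieldNormedType.Exports.

Set Implicit Arguments.
Unset Strict Implicit.
Unset Printing Implicit Defensive.

Local Open Scope classical_set_scope.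
Local Open Scope ring_scope.

(** * Means over independent random signs *)

Lemma expr_midpoint_le (R : realFieldType) (m : nat) (a b : R) :
  0 <= a -> 0 <= b -> ((a + b) / 2) ^+ m <= (a ^+ m + b ^+ m) / 2.
Proof.
move=> a0 b0; elim: m => [|m IH]; first by rewrite !expr0; lra.
have am0 : 0 <= a ^+ m by exact: exprn_ge0.
have bm0 : 0 <= b ^+ m by exact: exprn_ge0.
(* Chebyshev's inequality: the two factors have the same sign. *)
have ab : 0 <= (a - b) * (a ^+ m - b ^+ m).
  have [ab|/ltW ab] := lerP a b.
    by rewrite mulr_le0// subr_le0// lerXn2r.
  by rewrite mulr_ge0// subr_ge0// lerXn2r.
rewrite !exprS; apply: (le_trans (y := (a + b) / 2 * ((a ^+ m + b ^+ m) / 2))).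
  by rewrite ler_wpM2l//; lra.
nra.
Qed.

Section SignMean.
Variables (R : realType) (X : normedModType R).
Implicit Types (x y z : X) (s t : seq X) (F G : X -> R).

(** Expectation of F at the Rademacher sum of s. Recursion on s lets F vary in inductions;
    [sum_signs_sign_mean] links it to [rademacher_moment]. *)
Fixpoint sign_mean s F : R :=
  if s is x :: s' then
    (sign_mean s' (fun y => F (x + y)) + sign_mean s' (fun y => F (- x + y))) / 2
  else F 0.

Fixpoint sign_sums s : seq X :=
  if s is x :: s' then
    [seq x + y | y <- sign_sums s'] ++ [seq - x + y | y <- sign_sums s']
  else [:: 0].

Lemma eq_sign_mean s F G : F =1 G -> sign_mean s F = sign_mean s G.
Proof. by move=> /funext ->. Qed.

Lemma sign_meanD s F G :
  sign_mean s (fun y => F y + G y) = sign_mean s F + sign_mean s G.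
Proof.
by elim: s F G => [//|x s IH] F G /=; rewrite 2!IH; field.
Qed.

Lemma sign_meanZ s (c : R) F :
  sign_mean s (fun y => c * F y) = c * sign_mean s F.
Proof. by elim: s F => [//|x s IH] F /=; rewrite 2!IH; field. Qed.

Lemma sign_mean_cst s (c : R) : sign_mean s (fun=> c) = c.
Proof. by elim: s => [//|x s /= ->]; field. Qed.

Lemma ler_sign_mean s F G :
  (forall y, F y <= G y) -> sign_mean s F <= sign_mean s G.
Proof.
elim: s F G => [|x s IH] F G FG /=; first exact: FG.
by rewrite ler_wpM2r// lerD// IH.
Qed.

Lemma sign_mean_ge0 s F : (forall y, 0 <= F y) -> 0 <= sign_mean s F.
Proof. by move=> F0; rewrite -(sign_mean_cst s 0) ler_sign_mean. Qed.

Lemma sign_meanN s F : sign_mean s (fun y => F (- y)) = sign_mean s F.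
Proof.
elim: s F => [|x s IH] F /=; first by rewrite oppr0.
under eq_sign_mean do rewrite opprD.
rewrite (IH (fun y => F (- x + y))).
under [X in _ + X]eq_sign_mean do rewrite opprD opprK.
by rewrite (IH (fun y => F (x + y))) addrC.
Qed.

Lemma sign_mean_cat s t F :
  sign_mean (s ++ t) F = sign_mean s (fun y => sign_mean t (fun z => F (y + z))).
Proof.
elim: s F => [|x s IH] F /=; first by apply: eq_sign_mean => z; rewrite add0r.
rewrite 2!IH; congr ((_ + _) / 2); apply: eq_sign_mean => y;
by apply: eq_sign_mean => z; rewrite addrA.
Qed.

(** Since x is the midpoint of [x + a] and [x - a], convexity of the q-th power of the norm handles
    one sign at a time. *)
Lemma sign_mean_normX_ge (q : nat) s x :
  `|x| ^+ q <= sign_mean s (fun y => `|x + y| ^+ q).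
Proof.
elim: s x => [|a s IH] x /=; first by rewrite addr0.
apply: (le_trans (y := (`|x + a| ^+ q + `|x - a| ^+ q) / 2)); last first.
  by rewrite ler_wpM2r// lerD//; (under eq_sign_mean do rewrite addrA).
apply: (le_trans _ (expr_midpoint_le q (normr_ge0 _) (normr_ge0 _))).
rewrite lerXn2r// ?nnegrE ?divr_ge0// ?addr_ge0// ler_pdivlMr//.
have -> : `|x| * 2 = `|(x + a) + (x - a)|.
  by rewrite addrACA subrr addr0 -mulr2n normrMn mulr_natr.
exact: ler_normD.
Qed.

Lemma sign_mean_normX_catl (q : nat) s t :
  sign_mean s (fun y => `|y| ^+ q) <= sign_mean (s ++ t) (fun y => `|y| ^+ q).
Proof. by rewrite sign_mean_cat ler_sign_mean// => y; exact: sign_mean_normX_ge. Qed.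

Lemma sign_mean_catC s t F : sign_mean (s ++ t) F = sign_mean (t ++ s) F.
Proof.
elim: s t F => [|x s IH] t F /=; first by rewrite cats0.
rewrite 2!IH !sign_mean_cat /= -sign_meanD.
under [RHS]eq_sign_mean do rewrite -[_ / 2]mulrC.
rewrite sign_meanZ mulrC; congr (_ * _).
apply: eq_sign_mean => y; congr (_ + _); apply: eq_sign_mean => z;
by rewrite addrCA.
Qed.

(** Once x is rotated to the front, convexity applies under either of its signs. *)
Lemma sign_mean_normX_mem (q : nat) s x : x \in s ->
  `|x| ^+ q <= sign_mean s (fun y => `|y| ^+ q).
Proof.
move=> /rot_index xs; rewrite -(cat_take_drop (index x s) s) sign_mean_catC.
move: xs; rewrite /rot => -> /=.
rewrite ler_pdivlMr// mulr_natr mulr2n lerD//.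
  exact: sign_mean_normX_ge.
rewrite -[in leLHS]normrN; exact: sign_mean_normX_ge.
Qed.

Lemma sign_mean_ge_sum s F z : (forall y, 0 <= F y) -> z \in sign_sums s ->
  (2 ^+ size s)^-1 * F z <= sign_mean s F.
Proof.
elim: s F z => [|x s IH] F z F0 /=.
  by rewrite inE => /eqP ->; rewrite expr0 invr1 mul1r.
have m0 (u : X) : 0 <= sign_mean s (fun y => F (u + y)) by exact: sign_mean_ge0.
have m1 (u y : X) : y \in sign_sums s ->
    (2 ^+ size s)^-1 * F (u + y) <= sign_mean s (fun y => F (u + y)).
  exact: (IH (fun y => F (u + y))).
rewrite exprS invfM -mulrA [leRHS]mulrC.
rewrite mem_cat => /orP[] /mapP[y ys ->]; rewrite ler_wpM2l//.
  by apply: le_trans (m1 _ _ ys) _; rewrite lerDl.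
by apply: le_trans (m1 _ _ ys) _; rewrite lerDr.
Qed.

(** Expectation of G at the list of independent Rademacher sums of the blocks; keeping a list allows
    fresh signs in front of its entries. *)
Fixpoint block_mean (ss : seq (seq X)) (G : seq X -> R) : R :=
  if ss is s :: ss' then
    sign_mean s (fun y => block_mean ss' (fun l => G (y :: l)))
  else G [::].

Lemma block_meanD ss (G H : seq X -> R) :
  block_mean ss (fun l => G l + H l) = block_mean ss G + block_mean ss H.
Proof.
elim: ss G H => [//|s ss IH] G H /=; rewrite -sign_meanD.
by apply: eq_sign_mean => y; rewrite IH.
Qed.

Lemma block_meanZ ss (c : R) (G : seq X -> R) :
  block_mean ss (fun l => c * G l) = c * block_mean ss G.
Proof.
elim: ss G => [//|s ss IH] G /=; rewrite -sign_meanZ.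
by apply: eq_sign_mean => y; rewrite IH.
Qed.

Lemma ler_block_mean ss (G H : seq X -> R) :
  (forall l, size l = size ss -> G l <= H l) -> block_mean ss G <= block_mean ss H.
Proof.
elim: ss G H => [|s ss IH] G H GH /=; first exact: GH.
by apply: ler_sign_mean => y; apply: IH => l sl; apply: GH; rewrite /= sl.
Qed.

Lemma block_mean_cst ss (c : R) : block_mean ss (fun=> c) = c.
Proof.
elim: ss => [//|s ss IH] /=; under eq_sign_mean do rewrite IH.
exact: sign_mean_cst.
Qed.

(* The law of each block sum is symmetric, so independent signs in front of the
   block sums change nothing. *)
Lemma sign_mean_flatten ss F :
  sign_mean (flatten ss) F = block_mean ss (fun l => sign_mean l F).
Proof.
elim: ss F => [//|s ss IH] F /=.
rewrite sign_mean_cat.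
under [RHS]eq_sign_mean => y.
  under eq_fun do rewrite -[_ / 2]mulrC.
  rewrite block_meanZ block_meanD -!IH.
  over.
rewrite /= sign_meanZ sign_meanD.
rewrite (sign_meanN s (fun y => sign_mean (flatten ss) (fun z => F (y + z)))).
by field.
Qed.

Lemma block_mean_sum ss F :
  block_mean ss (fun l => \sum_(y <- l) F y) = \sum_(s <- ss) sign_mean s F.
Proof.
elim: ss => [|s ss IH] /=; first by rewrite !big_nil.
rewrite big_cons -IH.
under eq_sign_mean => y.
  under eq_fun do rewrite big_cons.
  rewrite block_meanD block_mean_cst.
  over.
by rewrite sign_meanD sign_mean_cst.
Qed.

Lemma sign_mean_jensen s F (m : nat) : (forall y, 0 <= F y) ->
  sign_mean s F ^+ m <= sign_mean s (fun y => F y ^+ m).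
Proof.
elim: s F => [//|x s IH] F F0 /=.
apply: le_trans (expr_midpoint_le _ _ _) _; rewrite ?sign_mean_ge0//.
by rewrite ler_wpM2r// lerD// IH.
Qed.

End SignMean.

(** * Cutting a sequence into blocks of comparable weight *)

Lemma prefix_weight (R : realType) (T : eqType) (w : T -> R) (h c : R) (s : seq T) :
  0 <= h -> (forall x, x \in s -> w x <= h) -> 0 <= c <= \sum_(x <- s) w x ->
  exists s1 s2, s = s1 ++ s2 /\ c <= \sum_(x <- s1) w x <= c + h.
Proof.
move=> h0; elim: s c => [|x s IH] c wh /andP[c0].
  by rewrite big_nil => c0'; exists [::], [::]; rewrite big_nil c0' addr_ge0.
rewrite big_cons => cs; have wx : w x <= h by rewrite wh ?mem_head.
have [cx|xc] := lerP c (w x).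
  by exists [:: x], s; rewrite big_seq1; split=> //; lra.
have [||s1 [s2 [-> ?]]] := IH (c - w x).
- by move=> y ys; rewrite wh// inE ys orbT.
- by lra.
by exists (x :: s1), s2; rewrite big_cons; split=> //; lra.
Qed.

(** Greedy cutting: a prefix stopped once its weight reaches h weighs at most 2h, so enough weight
    is left for the other blocks. *)
Lemma blocks_weight (R : realType) (T : eqType) (w : T -> R) (h : R) (n : nat)
    (s : seq T) :
  0 <= h -> (forall x, x \in s -> w x <= h) ->
  n%:R * (2 * h) <= \sum_(x <- s) w x ->
  exists ss rest, [/\ s = flatten ss ++ rest, size ss = n &
    forall b, b \in ss -> h <= \sum_(x <- b) w x <= 2 * h].
Proof.
move=> h0; elim: n s => [|n IH] s wh; first by exists [::], s.
rewrite -natr1 => ns.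
have nh : 0 <= n%:R * (2 * h) by rewrite !mulr_ge0.
have [|s1 [s2 [ss12 hs1]]] := prefix_weight (c := h) h0 wh; first by lra.
subst s; rewrite big_cat /= in ns.
have [||ss [rest [-> sn ssP]]] := IH s2.
- by move=> x xs; rewrite wh// mem_cat xs orbT.
- by lra.
exists (s1 :: ss), rest; rewrite /= catA sn; split=> // b.
by rewrite inE => /orP[/eqP ->|/ssP//]; lra.
Qed.

Lemma mem_flatten_subseq (T : eqType) (b : seq T) (ss : seq (seq T)) :
  b \in ss -> subseq b (flatten ss).
Proof.
elim: ss => [//|c ss IH]; rewrite inE => /orP[/eqP ->|/IH bs] /=.
  exact: prefix_subseq.
exact: subseq_trans bs (suffix_subseq _ _).
Qed.

Lemma exprn_unbounded (R : archiRealFieldType) (a b : R) : 1 < a ->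
  exists2 k : nat, (2 <= k)%N & b <= a ^+ k.
Proof.
move=> a1; have a10 : 0 < a - 1 by lra.
pose q := (Num.trunc (b / (a - 1))).+2.
exists q => //.
have bern (k : nat) : k%:R * (a - 1) <= a ^+ k.
  elim: k => [|k IH]; first by rewrite mul0r.
  have : 1 <= a ^+ k by rewrite exprn_ege1// ltW.
  by rewrite -natr1 exprS; nra.
apply: le_trans (bern q); rewrite -ler_pdivrMr//.
by apply: ltW; apply: (lt_trans (truncnS_gt _)); rewrite ltr_nat.
Qed.

(** * Cotype inequalities from large sign sums *)

Section CotypeFromSignSums.
Variables (R : realType) (X : normedModType R).
Implicit Types (x y z : X) (s l : seq X).

(* If all vectors have nearly the same norm, one large sign sum contributes
   2^-n lam^q to the q-th moment, which is huge for large q; otherwise one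
   vector is negligible in the sum of the q-th powers. *)
Lemma sum_normX_le_sign_mean (n : nat) (lam : R) : 1 < lam ->
  (forall l (c : R), size l = n.+1 -> 0 < c -> (forall x, x \in l -> c <= `|x|) ->
    exists2 z, z \in sign_sums l & lam * lam * c <= `|z|) ->
  exists2 q : nat, (2 <= q)%N & forall l, size l = n.+1 ->
    2 * \sum_(x <- l) `|x| ^+ q <=
    (2 * n.+1%:R - 1) * sign_mean l (fun y => `|y| ^+ q).
Proof.
move=> lam1 Hlam.
(* Of [2 ^+ n.+2], a factor [2 ^+ n.+1] pays for the probability of one sign pattern and a factor 2
   is left. *)
have [q q2 lamq] := exprn_unbounded (2 ^+ n.+2) lam1.
exists q => // l sl.
have [x0 x0l] : exists x, x \in l.
  by case: l sl => // x l _; exists x; rewrite mem_head.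
have [y yl ymax] : exists2 y, y \in l & forall x, x \in l -> `|x| <= `|y|.
  elim: (l) x0 x0l => [//|a l' IH] x0 _.
  case: l' IH => [|b l'] IH.
    by exists a; rewrite ?mem_head// => x; rewrite inE => /eqP ->.
  have [|y yl ymax] := IH b; first by rewrite mem_head.
  have [ay|/ltW ya] := lerP `|a| `|y|.
    exists y; first by rewrite inE yl orbT.
    by move=> x; rewrite inE => /orP[/eqP ->//|/ymax].
  exists a; first by rewrite mem_head.
  by move=> x; rewrite inE => /orP[/eqP ->//|/ymax xy]; exact: le_trans ya.
pose mu := `|y|; have {}ymax x : x \in l -> `|x| <= mu by exact: ymax.
have mu_ge0 : 0 <= mu by exact: normr_ge0.
have mu0 : 0 <= mu ^+ q by exact: exprn_ge0.
have muE : mu ^+ q <= sign_mean l (fun y => `|y| ^+ q) by exact: sign_mean_normX_mem.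
have nge1 : 1 <= n.+1%:R :> R by rewrite ler1n.
have xmu x : x \in l -> `|x| ^+ q <= mu ^+ q by move=> /ymax xy; rewrite lerXn2r ?nnegrE.
have summu s : {subset s <= l} -> \sum_(x <- s) `|x| ^+ q <= (size s)%:R * mu ^+ q.
  elim: s => [|x s IH] sl'; first by rewrite big_nil mul0r.
  rewrite big_cons /= -natr1 mulrDl mul1r addrC lerD//.
    by apply: IH => z zs; rewrite sl'// inE zs orbT.
  by rewrite xmu// sl'// mem_head.
have [small|large] := pselect (exists2 x, x \in l & `|x| * lam <= mu).
  have [x xl xmul] := small.
  (* The negligible vector weighs at most half of [mu ^+ q], and twice [n + 1/2] is
     [2 * n.+1 - 1]. *)
  suff sumle : \sum_(x <- l) `|x| ^+ q <= (n%:R + 2^-1) * mu ^+ q.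
    rewrite -natr1 in nge1 *.
    apply: (le_trans (y := (2 * (n%:R + 1) - 1) * mu ^+ q)).
      by apply: le_trans (ler_wpM2l _ sumle) _ => //; lra.
    by rewrite ler_wpM2l//; lra.
  rewrite (big_rem x)//= addrC mulrDl lerD//.
    have -> : n = size (rem x l) by rewrite size_rem// sl.
    by rewrite summu// => z /mem_rem.
  have : `|x| ^+ q * lam ^+ q <= mu ^+ q by rewrite -exprMn lerXn2r// nnegrE ?mulr_ge0//; lra.
  have : 2 <= lam ^+ q.
    by apply: le_trans lamq; rewrite exprS ler_peMr// exprn_ege1// ler1n.
  have : 0 <= `|x| ^+ q by rewrite exprn_ge0.
  nra.
have lam0 : 0 < lam by lra.
have mupos : 0 < mu.
  rewrite lt_neqAle mu_ge0 andbT; apply/negP => /eqP mu00; apply: large.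
  exists y => //; rewrite -/mu -mu00 mul0r//.
(* All norms are now at least [mu / lam]; of the factor [lam * lam], one [lam] survives. *)
have [||z zl zbig] := Hlam l (mu / lam) sl.
- by rewrite divr_gt0.
- move=> x xl; rewrite ler_pdivrMr// leNgt; apply/negP => /ltW xs.
  by apply: large; exists x.
have lammu : lam * lam * (mu / lam) = lam * mu by field; rewrite gt_eqF.
rewrite lammu in zbig.
have big : 2 * mu ^+ q <= sign_mean l (fun y => `|y| ^+ q).
  apply: le_trans (sign_mean_ge_sum (F := fun y => `|y| ^+ q) _ zl); last first.
    by move=> u; rewrite exprn_ge0.
  have : (lam * mu) ^+ q <= `|z| ^+ q by rewrite lerXn2r ?nnegrE ?normr_ge0 ?mulr_ge0 ?(ltW lam0).
  rewrite exprMn => zq; rewrite sl [leRHS]mulrC ler_pdivlMr ?exprn_gt0//; apply: le_trans zq.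
  by rewrite mulrAC -exprS ler_wpM2r.
have : \sum_(x <- l) `|x| ^+ q <= n.+1%:R * mu ^+ q by rewrite -sl summu.
nra.
Qed.

Section Induction.
Variables (N q m : nat).
Hypothesis N2 : (2 <= N)%N.
Hypothesis blockP : forall l, size l = N ->
  2 * \sum_(x <- l) `|x| ^+ q <=
  (2 * N%:R - 1) * sign_mean l (fun y => `|y| ^+ q).
Hypothesis mN : 2 * N%:R <= (2 * N%:R / (2 * N%:R - 1)) ^+ m :> R.

(* Split s into N consecutive blocks of comparable weight: blockP makes the q-th
   moment of one of them smaller than that of s by the factor 2N / (2N - 1),
   whose m-th power compensates the loss of weight. *)
Lemma sum_normX_le_sign_meanX s :
  \sum_(x <- s) `|x| ^+ (q * m) <=
  2 * N%:R * sign_mean s (fun y => `|y| ^+ q) ^+ m.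
Proof.
have N2' : 2 <= N%:R :> R by rewrite (ler_nat _ 2).
have [k] := ubnP (size s); elim: k s => // k IH s sk.
set W := \sum_(x <- s) _; set Q := sign_mean _ _.
have Q0 : 0 <= Q by apply: sign_mean_ge0 => y; rewrite exprn_ge0.
rewrite leNgt; apply/negP => QW.
(* With this h, N blocks of weight at most 2h fit into the total weight W. *)
pose h := W / (2 * N%:R).
(* The negated claim makes h exceed [Q ^+ m], hence every single weight. *)
have Qh : Q ^+ m < h by rewrite ltr_pdivlMr; [rewrite mulrC | lra].
have h0 : 0 < h by apply: le_lt_trans Qh; rewrite exprn_ge0.
have sh x : x \in s -> `|x| ^+ (q * m) <= h.
  move=> xs; apply: le_trans (ltW Qh); rewrite exprM lerXn2r// ?nnegrE ?exprn_ge0//.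
  exact: sign_mean_normX_mem.
have hW : N%:R * (2 * h) = W by rewrite /h; field; rewrite gt_eqF//; lra.
have [|ss [rest [sE sN ssP]]] := blocks_weight (n := N) (ltW h0) sh.
  by rewrite hW.
pose Qb b := sign_mean b (fun y => `|y| ^+ q).
have Qb0 b : 0 <= Qb b by apply: sign_mean_ge0 => y; rewrite exprn_ge0.
(* [blockP] is applied to each realisation of the N block sums and then averaged. *)
have sumQ : 2 * \sum_(b <- ss) Qb b <= (2 * N%:R - 1) * Q.
  rewrite -block_mean_sum -block_meanZ.
  apply: (le_trans (y := block_mean ss (fun l =>
     (2 * N%:R - 1) * sign_mean l (fun y => `|y| ^+ q)))).
    by apply: ler_block_mean => l sl; apply: blockP; rewrite sl.
  rewrite block_meanZ -sign_mean_flatten ler_wpM2l//; first by lra.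
  by rewrite /Q sE sign_mean_normX_catl.
(* Otherwise adding up the N reverse inequalities contradicts [sumQ]. *)
have [b bss bQ] : exists2 b, b \in ss & 2 * N%:R / (2 * N%:R - 1) * Qb b <= Q.
  apply: contrapT => nob.
  have {}nob b : b \in ss -> Q * (2 * N%:R - 1) < 2 * N%:R * Qb b.
    move=> bss; rewrite ltNge; apply/negP => bQ; apply: nob; exists b => //.
    by rewrite mulrAC ler_pdivrMr//; lra.
  have : (size ss)%:R * (Q * (2 * N%:R - 1)) < 2 * N%:R * \sum_(b <- ss) Qb b.
    have : ss != [::] by rewrite -size_eq0 sN; case: (N) N2.
    elim: (ss) nob => [//|c cs IHc] nob _.
    rewrite big_cons /= -natr1 [ltRHS]mulrDr [ltLHS]mulrDl.
    rewrite mul1r addrC ltr_leD ?nob ?mem_head//.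
    case: cs IHc nob => [_ _|d cs IHc nob]; first by rewrite big_nil mulr0 mul0r.
    by rewrite ltW// IHc// => e ed; rewrite nob// inE ed orbT.
  by rewrite sN; nra.
have /andP[hb bh] := ssP b bss.
(* A block weighs at most [2 * h = W / N < W], so it is not all of s. *)
have bs : (size b < size s)%N.
  have sub : subseq b s.
    by rewrite sE (subseq_trans (mem_flatten_subseq bss))// prefix_subseq.
  rewrite ltn_neqAle size_subseq// andbT; apply/negP => /eqP bs.
  have bE : b = s by apply/eqP; rewrite -(size_subseq_leqif sub) bs.
  by move: bh; rewrite bE -/W -hW; nra.
have {}IH := IH b (leq_trans bs sk).
rewrite -/(Qb b) in IH.
have Qbm0 : 0 <= Qb b ^+ m by rewrite exprn_ge0.
have MQ : (2 * N%:R / (2 * N%:R - 1)) ^+ m * Qb b ^+ m <= Q ^+ m.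
  by rewrite -exprMn lerXn2r// nnegrE mulr_ge0// divr_ge0//; lra.
(* The weight of b is at least h, but by induction at most [2 * N * Qb b ^+ m <= Q ^+ m < h]. *)
have := le_trans (le_trans hb IH) (le_trans (ler_wpM2r Qbm0 mN) MQ).
by rewrite leNgt Qh.
Qed.

End Induction.

End CotypeFromSignSums.

Lemma sum_signs_sign_mean (R : realType) (X : normedModType R) (n : nat)
    (x : 'I_n -> X) (F : X -> R) :
  (2 ^+ n)^-1 * \sum_(s : {ffun 'I_n -> bool}) F (\sum_(i < n) (-1) ^+ s i *: x i)
  = sign_mean [seq x i | i <- enum 'I_n] F.
Proof.
elim: n x F => [|n IH] x F.
  rewrite (eq_bigr (fun=> F 0)) => [|s _]; last by rewrite big_ord0.
  rewrite sumr_const cardE/=; last first.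
  by rewrite -cardE card_ffun !card_ord expn0 expr0 invr1 mul1r enum_ord0.
pose h (p : bool * {ffun 'I_n -> bool}) : {ffun 'I_n.+1 -> bool} :=
  [ffun i => if unlift ord0 i is Some j then p.2 j else p.1].
have hbij : bijective h.
  exists (fun s : {ffun 'I_n.+1 -> bool} => (s ord0, [ffun j => s (lift ord0 j)])).
    move=> [b t]; congr pair; first by rewrite ffunE unlift_none.
    by apply/ffunP => j; rewrite !ffunE liftK.
  move=> s; apply/ffunP => i; rewrite ffunE.
  by case: unliftP => [j ->|->]//=; rewrite ffunE.
rewrite (reindex h) /=; last exact: onW_bij.
rewrite -(pair_bigA _ (fun b t => F (\sum_(i < n.+1) (-1) ^+ h (b, t) i *: x i))) /=.
rewrite big_bool enum_ordSl /= -map_comp -!IH exprS invfM.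
have hE b t : \sum_(i < n.+1) (-1) ^+ h (b, t) i *: x i =
    (-1) ^+ b *: x ord0 + \sum_(i < n) (-1) ^+ t i *: x (lift ord0 i).
  rewrite big_ord_recl ffunE unlift_none; congr (_ + _).
  by apply: eq_bigr => i _; rewrite ffunE liftK.
under eq_bigr do rewrite hE expr1 scaleN1r.
under [X in _ * (_ + X)]eq_bigr do rewrite hE expr0 scale1r.
by rewrite /=; field; rewrite expf_neq0.
Qed.

(** * Almost isometric copies of finite-dimensional l_infty *)

Section Linfty.
Variables (R : realType) (X : normedModType R).

(** Jensen's inequality bounds the m-th power of the q-th moment by the moment of order [q * m], the
    cotype exponent. Used contrapositively: without cotype, some [n.+2] vectors have only small sign
    sums. *)
Lemma cotype_of_sign_sums (n : nat) (lam : R) : 1 < lam ->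
  (forall (l : seq X) (c : R), size l = n.+2 -> 0 < c ->
    (forall x, x \in l -> c <= `|x|) ->
    exists2 z, z \in sign_sums l & lam * lam * c <= `|z|) ->
  exists q : R, rademacher_cotype X q.
Proof.
move=> lam1 Hlam.
have [q q2 blockP] := sum_normX_le_sign_mean lam1 Hlam.
set N := n.+2 in blockP; pose M : R := 2 * N%:R / (2 * N%:R - 1).
have N2 : 2 <= N%:R :> R by rewrite (ler_nat _ 2).
have [m m2 mN] : exists2 m : nat, (2 <= m)%N & 2 * N%:R <= M ^+ m.
  by apply: exprn_unbounded; rewrite /M ltr_pdivlMr; lra.
have qm0 : 0 < (q * m)%:R :> R by rewrite ltr0n muln_gt0 !(ltn_trans _ q2, ltn_trans _ m2).
exists (q * m)%:R; split; first by rewrite (ler_nat _ 2) (leq_trans q2)// leq_pmulr// (ltn_trans _ m2).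
have C0 : 0 <= 2 * N%:R :> R by lra.
exists ((2 * N%:R) `^ (q * m)%:R^-1); first by rewrite powR_gt0; lra.
move=> k x; rewrite -powRM//; last first.
  by rewrite /rademacher_moment mulr_ge0 ?invr_ge0 ?exprn_ge0// sumr_ge0// => s _; rewrite powR_ge0.
have sum0 : 0 <= \sum_(i < k) `|x i| `^ (q * m)%:R.
  by rewrite sumr_ge0// => i _; rewrite powR_ge0.
rewrite ge0_ler_powR ?invr_ge0 ?(ltW qm0) ?nnegrE//.
  by rewrite mulr_ge0// /rademacher_moment mulr_ge0 ?invr_ge0 ?exprn_ge0// sumr_ge0// => s _; rewrite powR_ge0.
rewrite /rademacher_moment.
under eq_bigr do rewrite powR_mulrn//.
under [in leRHS]eq_bigr do rewrite powR_mulrn//.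
rewrite (sum_signs_sign_mean x (fun y => `|y| ^+ (q * m))).
have := sum_normX_le_sign_meanX (ltac:(by []) : (2 <= N)%N) blockP mN [seq x i | i <- enum 'I_k].
rewrite big_map big_enum /= => /le_trans; apply.
rewrite ler_wpM2l//; under [leRHS]eq_sign_mean do rewrite exprM.
by apply: sign_mean_jensen => y; rewrite exprn_ge0.
Qed.

(** Equivalence, with constants 1 and K, to the unit vectors of l_infty on I. Upper bounds B stand
    in for the sup norm of a, so empty I is covered. *)
Definition linfty_basis (K : R) (I : finType) (x : I -> X) : Prop :=
  (forall (a : I -> R) (B : R), 0 <= B -> (forall i, `|a i| <= B) ->
    `|\sum_i a i *: x i| <= K * B) /\
  (forall (a : I -> R) i, `|a i| <= `|\sum_i a i *: x i|).

Lemma linfty_basis_inj (K : R) (I J : finType) (x : J -> X) (h : I -> J) :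
  injective h -> linfty_basis K x -> linfty_basis K (x \o h).
Proof.
move=> hI [ub lb]; pose ext (a : I -> R) j := \sum_(i | h i == j) a i.
have extE a : \sum_j ext a j *: x j = \sum_i a i *: (x \o h) i.
  rewrite (partition_big h xpredT)//=; apply: eq_bigr => j _.
  by rewrite scaler_suml; apply: eq_bigr => i /eqP ->.
have exth a i : ext a (h i) = a i.
  by rewrite /ext (eq_bigl (xpred1 i)) ?big_pred1_eq// => k; rewrite (inj_eq hI).
split=> [a B B0 aB|a i]; last by rewrite -extE -exth lb.
rewrite -extE ub// => j.
have [[i <-]|nj] := pselect (exists i, h i = j); first by rewrite exth.
by rewrite /ext big_pred0 ?normr0// => i; apply/eqP => ij; apply: nj; exists i.
Qed.

(** A convex function on a cube is largest at a vertex. The induction replaces one coefficient at a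
    time by signs, u collecting the terms already treated. *)
Lemma ler_norm_sign_sums (l : seq X) (u : X) (D : R) (a : nat -> R) :
  (forall z, z \in sign_sums l -> `|u + z| <= D) -> (forall k, `|a k| <= 1) ->
  `|u + \sum_(k < size l) a k *: l`_k| <= D.
Proof.
elim: l u a => [|x l IH] u a lD a1.
  by rewrite big_ord0 lD//= mem_head.
rewrite /= big_ord_recl /=; set S := \sum_(k < _) _.
pose t := (1 + a 0%N) / 2.
have /andP[t0 t1] : 0 <= t <= 1.
  by have := a1 0%N; rewrite ler_norml /t => /andP[]; lra.
have uxS (e : R) : e = 1 \/ e = -1 -> `|u + e *: x + S| <= D.
  move=> e1; apply: (IH _ (fun k => a k.+1)) => // z zl.
  rewrite -addrA lD//= mem_cat; case: e1 => ->.
    by rewrite scale1r map_f.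
  by rewrite scaleN1r map_f ?orbT.
have -> : u + (a 0%N *: x + S) =
    t *: (u + 1 *: x + S) + (1 - t) *: (u + -1 *: x + S).
  rewrite !scalerDr !scalerA [RHS]addrACA [X in _ = X + _]addrACA -!scalerDl addrA.
  by rewrite [t + _]addrC subrK !scale1r; congr (_ + _ *: _ + _); rewrite /t; field.
have t1' : 0 <= 1 - t by rewrite subr_ge0.
rewrite (le_trans (ler_normD _ _))// (normrZ t) (normrZ (1 - t)) (ger0_norm t0) (ger0_norm t1').
apply: (le_trans (y := t * D + (1 - t) * D)).
  by apply: lerD; apply: ler_wpM2l => //; apply: uxS; [left | right].
by rewrite -mulrDl addrC subrK mul1r.
Qed.

Lemma linfty_basis_ord (n : nat) (K : R) : 1 < K -> no_nontrivial_cotype X ->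
  exists x : 'I_n.+2 -> X, linfty_basis K x.
Proof.
(* L solves [L / (2 - L) = K], the ratio of the bounds [L * c] and [(2 - L) * c] obtained below. *)
move=> K1 noc; pose L : R := 2 * K / (1 + K).
have L1 : 1 < L by rewrite /L ltr_pdivlMr; lra.
have L2 : L < 2 by rewrite /L ltr_pdivrMr; lra.
have sqL : Num.sqrt L * Num.sqrt L = L by rewrite -expr2 sqr_sqrtr//; lra.
have sqL1 : 1 < Num.sqrt L by rewrite -[ltLHS]sqrtr1 ltr_sqrt//; lra.
have [l [c [sl c0 lc lL]]] : exists l : seq X, exists c : R, [/\ size l = n.+2, 0 < c,
    forall x, x \in l -> c <= `|x| & forall z, z \in sign_sums l -> `|z| <= L * c].
  apply: contrapT => nol.
  have [q] := @cotype_of_sign_sums n _ sqL1 (fun l c sl c0 lc => ltac:(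
    apply: contrapT => noz; apply: nol; exists l, c; split=> // z zl;
    rewrite leNgt; apply/negP => /ltW; rewrite -sqL => Lz; apply: noz; exists z => //)).
  exact: noc.
have ub (a : 'I_n.+2 -> R) (B : R) : 0 <= B -> (forall i, `|a i| <= B) ->
    `|\sum_i a i *: l`_i| <= L * c * B.
  rewrite le_eqVlt => /predU1P[<- a0|B0 aB].
    rewrite big1 ?normr0 ?mulr0// => i _.
    by move: (a0 i); rewrite normr_le0 => /eqP ->; rewrite scale0r.
  pose b k := a (inord k) / B.
  have := @ler_norm_sign_sums l 0 (L * c) b.
  have -> : 0 + \sum_(k < size l) b k *: l`_k = B^-1 *: \sum_i a i *: l`_i.
    rewrite add0r sl scaler_sumr; apply: eq_bigr => i _.
    by rewrite /b inord_val scalerA mulrC.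
  rewrite normrZ gtr0_norm ?invr_gt0// [_^-1 * _]mulrC ler_pdivrMr//; apply.
    by move=> z zl; rewrite add0r lL.
  by move=> k; rewrite /b normrM normfV (gtr0_norm B0) ler_pdivrMr// mul1r.
(* Flipping every sign but that of the largest coefficient [a j] gives a vector of norm at most
   [L * c * |a j|]; both vectors add up to a multiple of the j-th one, of norm at least
   [2 * c * |a j|]. *)
have lb (a : 'I_n.+2 -> R) i : (2 - L) * c * `|a i| <= `|\sum_i a i *: l`_i|.
  case: (@arg_maxP _ _ _ ord0 xpredT (fun i => `|a i|) isT) => j _ jmax0.
  have jmax k : `|a k| <= `|a j| by exact: jmax0.
  apply: (le_trans (y := (2 - L) * c * `|a j|)).
    by rewrite ler_wpM2l ?jmax// mulr_ge0//; lra.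
  pose b k := if k == j then a j else - a k.
  have bj k : `|b k| <= `|a j| by rewrite /b; case: ifP => _ //; rewrite normrN jmax.
  have bE : \sum_i b i *: l`_i + \sum_i a i *: l`_i = (2 * a j) *: l`_j.
    rewrite -big_split /= (bigD1 j)//= big1 ?addr0 => [|k /negbTE kj].
      by rewrite /b eqxx -scalerDl -mulr2n mulr_natl.
    by rewrite /b kj -scalerDl addNr scale0r.
  have := ub b _ (normr_ge0 _) bj.
  have := ler_normD (\sum_i b i *: l`_i) (\sum_i a i *: l`_i).
  rewrite bE normrZ normrM (@ger0_norm _ 2)//.
  have : c <= `|l`_j| by rewrite lc// mem_nth// sl.
  have := normr_ge0 (a j); nra.
have d0 : 0 < (2 - L) * c by rewrite mulr_gt0//; lra.
exists (fun i => ((2 - L) * c)^-1 *: l`_i).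
have E (a : 'I_n.+2 -> R) : \sum_i a i *: (((2 - L) * c)^-1 *: l`_i) =
    ((2 - L) * c)^-1 *: \sum_i a i *: l`_i.
  by rewrite scaler_sumr; apply: eq_bigr => i _; rewrite !scalerA mulrC.
split=> [a B B0 aB|a i]; rewrite E normrZ gtr0_norm ?invr_gt0// mulrC.
  rewrite ler_pdivrMr// (le_trans (ub a B B0 aB))// le_eqVlt; apply/orP; left.
  by apply/eqP; rewrite /L; field; rewrite gt_eqF//; lra.
by rewrite ler_pdivlMr// mulrC.
Qed.

Lemma linfty_basis_exists (K : R) (I : finType) : 1 < K -> no_nontrivial_cotype X ->
  exists x : I -> X, linfty_basis K x.
Proof.
move=> K1 noc; have [x xP] := linfty_basis_ord #|I| K1 noc.
have le2 : (#|I| <= #|I|.+2)%N by rewrite -addn2 leq_addr.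
exists (x \o (widen_ord le2 \o enum_rank)); apply: linfty_basis_inj xP.
by apply: inj_comp enum_rank_inj => i j /(congr1 val) /= ij; exact: val_inj.
Qed.

End Linfty.

(** * Norming functionals and copies of l_infty on which they vanish *)

Section DominatedGraph.
Variables (R : realType) (X : normedModType R).
Implicit Types (G H : set (X * R)) (u v e : X).

(* Graph of a linear functional of norm at most 1 on a subspace of X. *)
Definition dominated_graph G : Prop :=
  [/\ G (0, 0),
      forall v r w s t, G (v, r) -> G (w, s) -> G (v + t *: w, r + t * s) &
      forall v r, G (v, r) -> r <= `|v|].

(** The value c at e must lie between all [r - |v - e|] and all [|w + e| - s]; by the triangle
    inequality the supremum of the former does. If e is in the domain already, these bounds force
    its old value. *)
Lemma dominated_graph_extend G e : dominated_graph G ->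
  exists2 H, dominated_graph H & G `<=` H /\ exists c, H (e, c).
Proof.
move=> [G0 GL Gn].
have GZ v r t : G (v, r) -> G (t *: v, t * r).
  by move=> /(GL _ _ _ _ t G0); rewrite !add0r.
pose S := [set p.2 - `|p.1 - e| | p in G].
have key v r w s : G (v, r) -> G (w, s) -> r - `|v - e| <= `|w + e| - s.
  move=> Gv Gw; have := Gn _ _ (GL _ _ _ _ 1 Gv Gw).
  rewrite mul1r scale1r; have := ler_normD (v - e) (w + e).
  by rewrite addrACA [- e + _]addrC subrr addr0; lra.
have Sub : has_ubound S.
  by exists (`|0 + e| - 0) => _ [[v r] /= Gv <-]; exact: key.
have S0 : S !=set0 by exists (0 - `|0 - e|), (0, 0).
pose c := sup S.
have cl v r : G (v, r) -> r - c <= `|v - e|.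
  move=> Gv; have : r - `|v - e| <= c by apply: ub_le_sup => //; exists (v, r).
  by lra.
have cu w s : G (w, s) -> s + c <= `|w + e|.
  move=> Gw; have : c <= `|w + e| - s.
    by apply: ge_sup => // _ [[v r] /= Gv <-]; exact: key.
  by lra.
exists [set p | exists v r t, G (v, r) /\ p = (v + t *: e, r + t * c)]; last first.
  split; last by exists c, 0, 0, 1; rewrite !add0r scale1r mul1r.
  by move=> [v r] Gv; exists v, r, 0; rewrite scale0r mul0r !addr0.
split.
- by exists 0, 0, 0; rewrite scale0r mul0r !addr0.
- move=> _ _ _ _ t [v [r [a [Gv [-> ->]]]]] [w [s [b [Gw [-> ->]]]]].
  exists (v + t *: w), (r + t * s), (a + t * b); split; first exact: GL.
  by rewrite scalerDr scalerA mulrDr mulrA addrACA -scalerDl [X in (_, X)]addrACA -mulrDl.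
move=> _ _ [v [r [t [Gv [-> ->]]]]].
(* By homogeneity the bounds for [t = 1] and [t = -1] suffice. *)
have [t0|t0|->] := ltgtP t 0; last first.
- by rewrite scale0r mul0r !addr0 Gn.
- have tn0 : t != 0 by rewrite gt_eqF.
  have := cu _ _ (GZ _ _ t^-1 Gv).
  have -> : v + t *: e = t *: (t^-1 *: v + e).
    by rewrite scalerDr scalerA divff// scale1r.
  rewrite normrZ gtr0_norm// => /(ler_wpM2l (ltW t0)).
  by rewrite mulrDr mulrA divff// mul1r.
have tn0 : t != 0 by rewrite lt_eqF.
have nt0 : 0 < - t by rewrite oppr_gt0.
have := cl _ _ (GZ _ _ (- t)^-1 Gv).
have -> : v + t *: e = (- t) *: ((- t)^-1 *: v - e).
  by rewrite scalerBr scalerA divff ?oppr_eq0// scale1r scaleNr opprK.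
rewrite normrZ gtr0_norm// => /(ler_wpM2l (ltW nt0)).
by rewrite mulrBr mulrA divff ?oppr_eq0// mul1r mulNr opprK.
Qed.

(* Hahn-Banach for finitely many vectors. *)
Lemma norming_graph u (s : seq X) :
  exists G, [/\ dominated_graph G, G (u, `|u|) & forall e, e \in s -> exists c, G (e, c)].
Proof.
elim: s => [|e s [G [dG Gu Gs]]].
  exists [set p | exists t, p = (t *: u, t * `|u|)]; split=> //; last first.
    by exists 1; rewrite scale1r mul1r.
  split.
  - by exists 0; rewrite scale0r mul0r.
  - move=> _ _ _ _ t [a [-> ->]] [b [-> ->]]; exists (a + t * b).
    by rewrite scalerDl scalerA mulrDl mulrA.
  - by move=> _ _ [t [-> ->]]; rewrite normrZ ler_wpM2r// ler_norm.
have [H dH [GH [c He]]] := dominated_graph_extend e dG.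
exists H; split=> //; first exact: GH.
move=> f; rewrite inE => /predU1P[->|/Gs[d /GH]]; first by exists c.
by exists d.
Qed.

Lemma dominated_graph_sum G (I : Type) (r : seq I) (a : I -> R) (x : I -> X) :
  dominated_graph G -> (forall i, G (x i, 0)) -> G (\sum_(i <- r) a i *: x i, 0).
Proof.
move=> [G0 GL _] Gx; elim: r => [|i r IH]; first by rewrite big_nil.
rewrite big_cons addrC; have := GL _ _ _ _ (a i) IH (Gx i).
by rewrite mulr0 addr0.
Qed.

(** A zero of a functional on a plane, with coefficients of maximum modulus exactly 1 so that both
    bounds of [linfty_basis] survive. The larger value is divided by; if both vanish, [0 / 0 = 0]
    does the job. *)
Lemma vanishing_combination (c0 c1 : R) : exists a : bool -> R,
  [/\ forall b, `|a b| <= 1, exists b, `|a b| = 1 & a false * c0 + a true * c1 = 0].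
Proof.
have [c01|/ltW c10] := lerP `|c0| `|c1|.
  exists (fun b => if b then - (c0 / c1) else 1); split.
  - case; last by rewrite normr1.
    rewrite normrN normrM normfV; have [->|c1n0] := eqVneq c1 0.
      by rewrite normr0 invr0 mulr0.
    by rewrite ler_pdivrMr ?mul1r ?normr_gt0.
  - by exists false; rewrite normr1.
  - have [c10|c1n0] := eqVneq c1 0.
      move: c01; rewrite c10 normr0 normr_le0 => /eqP ->; ring.
    by field.
exists (fun b => if b then 1 else - (c1 / c0)); split.
- case; first by rewrite normr1.
  rewrite normrN normrM normfV; have [->|c0n0] := eqVneq c0 0.
    by rewrite normr0 invr0 mulr0.
  by rewrite ler_pdivrMr ?mul1r ?normr_gt0.
- by exists true; rewrite normr1.
- have [c00|c0n0] := eqVneq c0 0.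
    move: c10; rewrite c00 normr0 normr_le0 => /eqP ->; ring.
  by field.
Qed.

(* Each new vector costs a factor 2 in dimension: in the span of each pair of
   basis vectors a norming functional of u has a nontrivial zero. *)
Lemma linfty_basis_monotone (K : R) (us : seq X) (I : finType) :
  (forall J : finType, exists x : J -> X, linfty_basis K x) ->
  exists2 x : I -> X, linfty_basis K x &
    forall u (a : I -> R), u \in us -> `|u| <= `|u + \sum_i a i *: x i|.
Proof.
move=> exK; elim: us I => [|u us IH] I; first by have [x] := exK I; exists x.
have [e [eub elb] eus] := IH (I * bool)%type.
have [G [dG Gu Gs]] := norming_graph u (codom e).
have [p|c Gc] := choice (P := fun p r => G (e p, r)) _.
  by apply: Gs; exact: codom_f.
have [m mP] := choice (fun i => vanishing_combination (c (i, false)) (c (i, true))).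
pose x i := \sum_b m i b *: e (i, b).
have xE (a : I -> R) : \sum_i a i *: x i = \sum_p (a p.1 * m p.1 p.2) *: e p.
  transitivity (\sum_i \sum_b (a i * m i b) *: e (i, b)); last by rewrite pair_bigA; apply: eq_bigr => -[].
  by apply: eq_bigr => i _; rewrite scaler_sumr; apply: eq_bigr => b _; rewrite scalerA.
have Gx i : G (x i, 0).
  have [G0 GL _] := dG; have [_ _ <-] := mP i.
  rewrite /x big_bool /= addrC [_ + m i true * _]addrC addrC.
  have := GL _ _ _ _ (m i false) (GL _ _ _ _ (m i true) G0 (Gc (i, true))) (Gc (i, false)).
  by rewrite !add0r [X in (X, _)]addrC.
exists x; first split.
- move=> a B B0 aB; rewrite xE eub// => -[i b] /=.
  have [m1 _ _] := mP i.
  by rewrite normrM -[leRHS]mulr1 ler_pM.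
- move=> a i; have [_ [b mb] _] := mP i.
  by have := elb (fun p => a p.1 * m p.1 p.2) (i, b); rewrite /= normrM mb mulr1 xE.
move=> v a; rewrite inE => /predU1P[->|vus]; last by rewrite xE eus.
(* The functional is [|u|] at u and 0 at every [x i], hence [|u|] at the whole sum. *)
have [_ GL Gn] := dG; apply: Gn.
have := GL _ _ _ _ 1 Gu (dominated_graph_sum (index_enum I) a dG Gx).
by rewrite scale1r mulr0 addr0.
Qed.

End DominatedGraph.

(** * Polygonal paths *)

Section Interpolation.
Variables (R : realType) (X : normedModType R).

Definition interp (a : nat -> X) (t : R) : X :=
  let k := Num.trunc t in (1 - (t - k%:R)) *: a k + (t - k%:R) *: a k.+1.

(** At the right end [t = k.+1] the truncation has jumped to the next cell, but both formulas give
    [a k.+1]. *)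
Lemma interp_cell (a : nat -> X) (k : nat) (t : R) : k%:R <= t <= k.+1%:R ->
  interp a t = a k + (t - k%:R) *: (a k.+1 - a k).
Proof.
have lin (j : nat) (s : R) : (1 - s) *: a j + s *: a j.+1 = a j + s *: (a j.+1 - a j).
  by rewrite scalerBl scale1r scalerBr addrAC addrA.
move=> /andP[kt]; rewrite le_eqVlt => /predU1P[->|tk].
  rewrite /interp natrK subrr subr0 scale1r scale0r addr0.
  by rewrite -natr1 [_ + 1]addrC addrK scale1r addrC subrK.
by rewrite /interp (@truncn_def _ t k) ?kt// lin.
Qed.

(** The path is affine on each cell; a longer interval is cut at the first integer after s, by
    induction on the number of cells. *)
Lemma interp_lipschitz (a : nat -> X) (L s t : R) :
  (forall k, `|a k.+1 - a k| <= L) -> 0 <= s <= t ->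
  `|interp a t - interp a s| <= L * (t - s).
Proof.
move=> aL.
have cell (k : nat) u v : k%:R <= u -> u <= v -> v <= k.+1%:R ->
    `|interp a v - interp a u| <= L * (v - u).
  move=> ku uv vk; rewrite !(@interp_cell _ k) ?(ku, vk) ?(le_trans uv vk) ?(le_trans ku uv)//.
  rewrite opprD addrACA subrr add0r -scalerBl opprB addrA subrK.
  by rewrite normrZ ger0_norm ?subr_ge0// mulrC ler_wpM2r ?subr_ge0.
move=> /andP[]; have [n] := ubnP (Num.trunc t - Num.trunc s)%N.
elim: n s => // n IH s; rewrite ltnS => tsn s0 st.
have /andP[sl su] := truncn_itv s0.
have /andP[tl tu] := truncn_itv (le_trans s0 st).
have [ts|ts] := leqP (Num.trunc t) (Num.trunc s).
  apply: cell sl st _; rewrite (le_trans (ltW tu))// ler_nat.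
  by rewrite ltnS.
pose r : R := (Num.trunc s).+1%:R.
have rt : r <= t by apply: le_trans tl; rewrite ler_nat.
have sr : s <= r by exact: ltW.
have h1 : `|interp a r - interp a s| <= L * (r - s) by exact: cell sl sr _.
have h2 : `|interp a t - interp a r| <= L * (t - r).
  by apply: IH => //; rewrite natrK subnS prednK ?subn_gt0.
have := ler_normD (interp a t - interp a r) (interp a r - interp a s).
rewrite addrA subrK => /le_trans; apply.
by apply: le_trans (lerD h2 h1) _; rewrite -mulrDr addrA subrK.
Qed.

End Interpolation.

(** * Gluing Frechet embeddings of balls *)

Section Embedding.
Variables (R : realType) (X : normedModType R) (K : R).
Hypothesis K0 : 0 < K.
Hypothesis basis : forall J : finType, exists x : J -> X, linfty_basis K x.
Variables (A : metricType R) (o : A).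
Hypothesis lfA : locally_finite A.

(** The coordinates [d(x, p) - d(o, p)], for p in the finite ball, are 1-Lipschitz in x; for x in
    the ball the one at [p = x] recovers d(x, y). *)
Lemma frechet_embedding (us : seq X) (r : R) : exists psi : A -> X,
  [/\ psi o = 0,
      forall x y, `|psi x - psi y| <= K * mdist x y,
      forall x y, ball o r x -> mdist x y <= `|psi x - psi y| &
      forall u t x y, u \in us -> `|u| <= `|u + t *: (psi x - psi y)|].
Proof.
have /finite_seqP[s sE] := lfA o r.
have [e [eub elb] eus] := linfty_basis_monotone us 'I_(size s) basis.
pose pt (i : 'I_(size s)) := nth o s i.
pose psi x := \sum_i (mdist x (pt i) - mdist o (pt i)) *: e i.
have psiB x y : psi x - psi y = \sum_i (mdist x (pt i) - mdist y (pt i)) *: e i.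
  rewrite -sumrB; apply: eq_bigr => i _; rewrite -scalerBl; congr (_ *: _).
  by rewrite opprB addrA subrK.
exists psi; split.
- by rewrite /psi big1// => i _; rewrite subrr scale0r.
- move=> x y; rewrite psiB eub ?mdist_ge0// => i.
  have := metric_triangle x y (pt i); have := metric_triangle y x (pt i).
  by rewrite (metric_sym y x) ler_norml; lra.
- move=> x y; rewrite sE /= => xs.
  have xi : (index x s < size s)%N by rewrite index_mem.
  have := elb (fun i => mdist x (pt i) - mdist y (pt i)) (Ordinal xi).
  rewrite -psiB /pt /= nth_index// mdistxx sub0r normrN (metric_sym y x).
  by rewrite ger0_norm ?mdist_ge0.
move=> u t x y uus; rewrite psiB scaler_sumr.
under [in leRHS]eq_bigr do rewrite scalerA.
exact: eus.
Qed.

Lemma embedding_sequence (r : nat -> R) : exists psi : nat -> A -> X,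
  [/\ forall k, psi k o = 0,
      forall k x y, `|psi k x - psi k y| <= K * mdist x y,
      forall k x y, ball o (r k) x -> mdist x y <= `|psi k x - psi k y| &
      forall k t x y z w, ball o (r k) x -> ball o (r k) y ->
        `|psi k x - psi k y| <=
        `|psi k x - psi k y + t *: (psi k.+1 z - psi k.+1 w)|].
Proof.
pose good k psi := [/\ psi o = 0 :> X,
  forall x y, `|psi x - psi y| <= K * mdist x y &
  forall x y, ball o (r k) x -> mdist x y <= `|psi x - psi y|].
(* Dependent choice: the state carries k and the k-th map, whose differences over the k-th ball form
   the list [us] for the next map. *)
have [[k phi]|next nextP] := choice (P := fun (p : nat * (A -> X)) psi =>
    good p.1.+1 psi /\
    forall t x y z w, ball o (r p.1) x -> ball o (r p.1) y ->
        `|p.2 x - p.2 y| <= `|p.2 x - p.2 y + t *: (psi z - psi w)|) _.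
  have /finite_seqP[s sE] := lfA o (r k).
  have [psi [p1 p2 p3 p4]] := frechet_embedding [seq phi x - phi y | x <- s, y <- s] (r k.+1).
  exists psi; split=> //= t x y z w; rewrite sE /= => xs ys.
  by apply: p4; apply: allpairs_f.
have [psi0 [a0 b0 c0 _]] := frechet_embedding [::] (r 0%N).
pose psi := fix F k := if k is j.+1 then next (j, F j) else psi0.
have psiP k : good k (psi k) by case: k => [//|k]; have [] := nextP (k, psi k).
exists psi; split.
- by move=> k; have [] := psiP k.
- by move=> k; have [] := psiP k.
- by move=> k; have [] := psiP k.
- by move=> k; have [] := nextP (k, psi k).
Qed.

(** Let w be the combination. Monotonicity gives [(1 - t) |u| <= |w|], whence [t |v| <= 2 |w|] by
    the triangle inequality; adding, [d <= 3 |w|]. *)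
Lemma monotone_combination_ge (u v : X) (d t : R) : 0 <= t <= 1 ->
  d <= `|u| -> d <= `|v| -> (forall s, `|u| <= `|u + s *: v|) ->
  d / 3 <= `|(1 - t) *: u + t *: v|.
Proof.
move=> /andP[t0 t1] du dv umon.
have t1' : 0 <= 1 - t by lra.
have a : (1 - t) * `|u| <= `|(1 - t) *: u + t *: v|.
  move: t1'; rewrite le_eqVlt => /predU1P[<-|t1']; first by rewrite mul0r.
  have -> : (1 - t) *: u + t *: v = (1 - t) *: (u + (t / (1 - t)) *: v).
    by rewrite scalerDr scalerA mulrCA divff ?mulr1// gt_eqF.
  by rewrite normrZ gtr0_norm// ler_wpM2l// ltW.
have b : t * `|v| <= `|(1 - t) *: u + t *: v| + (1 - t) * `|u|.
  have := ler_normB ((1 - t) *: u + t *: v) ((1 - t) *: u).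
  by rewrite addrAC subrr add0r (normrZ t) (normrZ (1 - t)) !ger0_norm.
nra.
Qed.

(** From [ln (1 + z) <= z] at [z = (t - s) / (1 + s)]. The factor s is there because consecutive
    maps, at distance s from o, differ by up to a multiple of s. *)
Lemma ln1D_lipschitz (s t : R) : 0 <= s <= t ->
  0 <= ln (1 + t) - ln (1 + s) /\ s * (ln (1 + t) - ln (1 + s)) <= t - s.
Proof.
move=> /andP[s0 st].
have s1 : 0 < 1 + s by lra.
have t1 : 0 < 1 + t by lra.
have lst : ln (1 + s) <= ln (1 + t) by rewrite ler_ln ?posrE//; lra.
split; first by rewrite subr_ge0.
apply: (le_trans (y := (1 + s) * (ln (1 + t) - ln (1 + s)))).
  by rewrite ler_wpM2r ?subr_ge0//; lra.
rewrite -ln_div ?posrE// mulrC -ler_pdivlMr//.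
have -> : (1 + t) / (1 + s) = 1 + (t - s) / (1 + s) by field; rewrite gt_eqF.
by apply: le_ln1Dx; apply: lt_le_trans (divr_ge0 _ (ltW s1)); lra.
Qed.

Lemma locally_finite_embedding (eta : R) : 0 < eta -> exists f : A -> X,
  forall x y, (3^-1 - 2 * K * eta) * mdist x y <= `|f x - f y| /\
    `|f x - f y| <= (K + 2 * K * eta) * mdist x y.
Proof.
move=> eta0; pose g (t : R) := eta * ln (1 + t).
(* The radii make every x with [g (mdist o x) < k.+1] lie in the k-th ball. *)
have [psi [psi0 psi_le psi_ge psi_mon]] :=
  embedding_sequence (fun k => expR (k.+1%:R / eta)).
exists (fun x => interp (psi^~ x) (g (mdist o x))).
move=> x y; wlog xy : x y / mdist o x <= mdist o y.
  by move=> H; have [/H//|/ltW /H] := lerP (mdist o x) (mdist o y);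
     rewrite distrC metric_sym.
have s0 : 0 <= mdist o x by exact: mdist_ge0.
have [gg gl] := @ln1D_lipschitz (mdist o x) (mdist o y) ltac:(by rewrite s0).
have g0 : 0 <= g (mdist o x) by rewrite mulr_ge0 ?(ltW eta0)// ln_ge0//; lra.
set sx := g (mdist o x) in g0 *; set ty := g (mdist o y).
have sxty : sx <= ty by rewrite ler_wpM2l ?(ltW eta0)//; lra.
set d := mdist x y.
have d0 : 0 <= d by exact: mdist_ge0.
have dxy : mdist o y - mdist o x <= d by have := metric_triangle o x y; rewrite -/d; lra.
(* The parameter moves at fixed x: as [psi k o = 0], consecutive maps differ at x by at most
   [2 * K * mdist o x], which the slow growth of g absorbs. *)
have err : `|interp (psi^~ x) ty - interp (psi^~ x) sx| <= 2 * K * eta * d.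
  apply: le_trans (@interp_lipschitz _ _ _ (2 * K * mdist o x) _ _ _ _) _.
  - move=> k; apply: le_trans (ler_normB _ _) _.
    have := psi_le k x o; have := psi_le k.+1 x o.
    by rewrite !psi0 !subr0 metric_sym; lra.
  - by rewrite g0.
  have -> : 2 * K * mdist o x * (ty - sx) =
      2 * K * eta * (mdist o x * (ln (1 + mdist o y) - ln (1 + mdist o x))).
    by rewrite /ty /sx /g; ring.
  by rewrite ler_wpM2l ?mulr_ge0 ?(ltW K0) ?(ltW eta0)//; lra.
pose k := Num.trunc ty.
have ty0 : 0 <= ty by exact: le_trans sxty.
have /andP[kt tk] := truncn_itv ty0; rewrite -/k in kt tk.
pose t := ty - k%:R.
have t01 : 0 <= t <= 1 by rewrite /t; move: tk; rewrite -natr1; lra.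
(* The farther point y fixes the cell k, so both points lie in the balls of index k and [k.+1]. *)
have yr j : (k <= j)%N -> mdist o y < expR (j.+1%:R / eta).
  move=> kj; apply: (lt_le_trans (y := 1 + mdist o y)); first by lra.
  rewrite -[leLHS]lnK ?posrE; last by lra.
  rewrite ler_expR ler_pdivlMr// mulrC -/(g _) -/ty (le_trans (ltW tk))//.
  by rewrite ler_nat ltnS.
have byr j : (k <= j)%N -> ball o (expR (j.+1%:R / eta)) y.
  by move=> kj; rewrite ballEmdist /=; exact: yr.
have bxr j : (k <= j)%N -> ball o (expR (j.+1%:R / eta)) x.
  by move=> kj; rewrite ballEmdist /=; exact: le_lt_trans (yr j kj).
have main : interp (psi^~ y) ty - interp (psi^~ x) ty =
    (1 - t) *: (psi k y - psi k x) + t *: (psi k.+1 y - psi k.+1 x).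
  have comb (w : R) (a b c e : X) : (1 - w) *: a + w *: b - ((1 - w) *: c + w *: e) =
      (1 - w) *: (a - c) + w *: (b - e) by rewrite !scalerBr opprD addrACA.
  exact: comb.
have dE : mdist y x = d by rewrite metric_sym.
have lower : d / 3 <= `|interp (psi^~ y) ty - interp (psi^~ x) ty|.
  rewrite main; apply: monotone_combination_ge => //.
  - by rewrite -dE; apply: psi_ge; exact: byr.
  - by rewrite -dE; apply: psi_ge; exact: byr.
  - by move=> s; apply: psi_mon; [exact: byr | exact: bxr].
have upper : `|interp (psi^~ y) ty - interp (psi^~ x) ty| <= K * d.
  rewrite main (le_trans (ler_normD _ _))// (normrZ t) (normrZ (1 - t)).
  have /andP[t0 t1] := t01; rewrite !ger0_norm ?subr_ge0//.
  have -> : K * d = (1 - t) * (K * d) + t * (K * d) by rewrite -mulrDl subrK mul1r.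
  by apply: lerD; rewrite ler_wpM2l ?subr_ge0// -dE psi_le.
set P := interp (psi^~ y) ty in lower upper *; set Q := interp (psi^~ x) ty in err lower upper.
set S := interp (psi^~ x) sx in err *.
have := ler_distD Q P S; have := ler_distD S P Q.
by rewrite (distrC S P) (distrC S Q); lra.
Qed.

End Embedding.

Theorem theorem1p14 (R : realType) (X : completeNormedModType R)
  (hX : no_nontrivial_cotype X) : D_le_plus X 4.
Proof.
(* [D_le X 4] holds outright: as [1 <= C], distortion at most 4 suffices. *)
right=> C C1 A lfA _.
suff [f fP] : exists f : A -> X, C_bilipschitz [set: A] 4 f.
  exists f; first by exists 4.
  apply: (le_trans (y := 4)); last by rewrite ler_peMr.
  by apply: ge_inf => //; exists 1 => D; case.
(* An empty A offers no base point. *)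
have [noA|/existsNP[a _]] := pselect (forall a : A, False).
  by exists (fun=> 0); split=> //; [rewrite ler1n | exists 1 => // u].
(* With [K = 10/9] and [eta = 1/80], [2 * K * eta = 1/36]: the bounds are [1/3 - 1/36 = 11/36] and
   [10/9 + 1/36 = 41/36 <= 4 * 11/36]. *)
have K1 : 1 < 10 / 9 :> R by lra.
have basis (J : finType) := linfty_basis_exists J K1 hX.
have eta0 : 0 < 80^-1 :> R by rewrite invr_gt0.
have [f fP] := locally_finite_embedding (lt_trans ltr01 K1) basis a lfA eta0.
exists f; split; first by rewrite ler1n.
exists (11 / 36) => // u v _ _; have [lo up] := fP u v.
have := mdist_ge0 u v; split; lra.
Qed.
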